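(* Let $C$ be a call pricing function, let $T>0$ be a fixed expiry, and let $I$ be the implied volatility associated with $C$; write $C(K)=C(T,K)$ and $I(K)=I(T,K)$. Let $\psi$ be a positive function with $\lim_{K\to\infty}\psi(K)=\infty$. Then, as $K\to\infty$, $$I(K)=\frac{1}{\sqrt{T}}\left[\sqrt{2\log K+2\log\frac{1}{C(K)}-\log\log\frac{1}{C(K)}}-\sqrt{2\log\frac{1}{C(K)}-\log\log\frac{1}{C(K)}}\right]+O\left(\left(\log\frac{1}{C(K)}\right)^{-\frac12}\psi(K)\right).$$
   Context: Fix $r\ge 0$ (interest rate) and $x_0>0$. A stock price process is a positive adapted process $X$ on a filtered probability space $(\Omega,\mathcal F,\mathcal F_t,\mathbb P^* )$ such that $X_0=x_0$ $\mathbb P^*$-a.s., $\mathbb E^*[X_t]<\infty$ for all $t\ge0$, $X_t$ is an unbounded random variable (i.e. $\mathbb P^*[X_t>K]>0$ for all $K$) for every $t>0$, and $e^{-rt}X_t$ is an $(\mathcal F_t,\mathbb P^* )$-martingale. The associated call pricing function is $C(T,K)=e^{-rT}\mathbb E^*[(X_T-K)^+]$, $T,K\ge0$. For each $T>0$ one has $C(T,K)>0$ for all $K>0$ and $C(T,K)\to0$ as $K\to\infty$. Black-Scholes function: $C_{BS}(T,K,\sigma)=x_0N(d_1)-Ke^{-rT}N(d_2)$, where $N$ is the standard normal distribution function, $d_1=\frac{\log x_0-\log K+(r+\sigma^2/2)T}{\sigma\sqrt T}$, $d_2=d_1-\sigma\sqrt T$ for $\sigma>0$, and $C_{BS}(T,K,0)=(x_0-Ke^{-rT})^+$.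 The implied volatility $I(T,K)$, $T,K>0$, is the unique number $\sigma\ge0$ with $C_{BS}(T,K,\sigma)=C(T,K)$. $\varphi_1(K)=\varphi_2(K)+O(\rho(K))$ as $K\to\infty$ means $|\varphi_1(K)-\varphi_2(K)|\le\alpha\rho(K)$ for some $\alpha>0$ and all sufficiently large $K$. *)

(* Defs.v *)
From HB Require Import structures.
From mathcomp Require Import all_boot all_order all_algebra.
From mathcomp Require Import all_classical all_reals all_analysis.

Set Implicit Arguments.
Unset Strict Implicit.
Unset Printing Implicit Defensive.

Import Order.TTheory GRing.Theory Num.Theory.
Import numFieldTopology.Exports numFieldNormedType.Exports.

Local Open Scope classical_set_scope.
Local Open Scope ring_scope.

(* Processes are indexed by all of R; only the times t >= 0 are constrained. *)

Definition is_filtration d (Omega : measurableType d) (R : realType)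
    (F : R -> set (set Omega)) : Prop :=
  [/\ forall t : R, 0 <= t -> sigma_algebra setT (F t),
      forall t : R, 0 <= t -> F t `<=` measurable
    & forall s t : R, 0 <= s -> s <= t -> F s `<=` F t].

Definition measurable_wrt d (Omega : measurableType d) (R : realType)
    (G : set (set Omega)) (Y : Omega -> R) : Prop :=
  forall B : set R, measurable B -> G (Y @^-1` B).

Definition adapted d (Omega : measurableType d) (R : realType)
    (F : R -> set (set Omega)) (X : R -> Omega -> R) : Prop :=
  forall t : R, 0 <= t -> measurable_wrt (F t) (X t).

(* Z is a version of the conditional expectation of Y given G *)
Definition is_cond_expectation d (Omega : measurableType d) (R : realType)
    (P : probability Omega R) (G : set (set Omega)) (Y Z : Omega -> R) : Prop :=
  [/\ measurable_wrt G Z,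
      P.-integrable setT (EFin \o Z)
    & forall A, G A ->
        (\int[P]_(w in A) (Z w)%:E = \int[P]_(w in A) (Y w)%:E)%E].

Definition martingale d (Omega : measurableType d) (R : realType)
    (P : probability Omega R) (F : R -> set (set Omega))
    (M : R -> Omega -> R) : Prop :=
  [/\ adapted F M,
      forall t : R, 0 <= t -> P.-integrable setT (EFin \o M t)
    & forall s t : R, 0 <= s -> s <= t -> is_cond_expectation P (F s) (M t) (M s)].

Record stock_price d (Omega : measurableType d) (R : realType)
    (P : probability Omega R) (F : R -> set (set Omega)) (r x0 : R)
    (X : R -> Omega -> R) : Prop := StockPrice {
  stock_price_gt0 : forall (t : R) w, 0 <= t -> 0 < X t w;
  stock_price_adapted : adapted F X;
  stock_price_init : {ae P, forall w, X 0 w = x0};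
  stock_price_finite : forall t : R, 0 <= t -> ('E_P[X t] < +oo)%E;
  stock_price_unbounded :
    forall t K : R, 0 < t -> (0 < P [set w | (K < X t w)%R])%E;
  stock_price_martingale :
    martingale P F (fun t w => expR (- (r * t)) * X t w)
}.

Definition call_price d (Omega : measurableType d) (R : realType)
    (P : probability Omega R) (r : R) (X : R -> Omega -> R) (T K : R) : R :=
  expR (- (r * T)) * fine 'E_P[fun w => Num.max (X T w - K) 0].

Definition std_normal_cdf (R : realType) (x : R) : R :=
  fine (normal_prob 0 1 `]-oo, x]).

Definition bs_d1 (R : realType) (r x0 T K sigma : R) : R :=
  (ln x0 - ln K + (r + sigma ^+ 2 / 2) * T) / (sigma * Num.sqrt T).

Definition bs_d2 (R : realType) (r x0 T K sigma : R) : R :=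
  bs_d1 r x0 T K sigma - sigma * Num.sqrt T.

Definition black_scholes (R : realType) (r x0 T K sigma : R) : R :=
  if sigma == 0 then Num.max (x0 - K * expR (- (r * T))) 0
  else x0 * std_normal_cdf (bs_d1 r x0 T K sigma)
       - K * expR (- (r * T)) * std_normal_cdf (bs_d2 r x0 T K sigma).

(* When C is a call pricing function and T, K > 0, the set below has exactly
   one element, so the value 0 that xget returns on the empty set plays no
   role. *)
Definition implied_vol (R : realType) (r x0 : R) (C : R -> R -> R)
    (T K : R) : R :=
  xget 0 [set sigma | 0 <= sigma /\ black_scholes r x0 T K sigma = C T K].

(* phi1 = phi2 + O(rho) at +oo; unlike in the bigO of the library, rho and not
   its absolute value is on the right-hand side *)
Definition eq_addO_pinfty (R : realType) (phi1 phi2 rho : R -> R) : Prop :=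
  exists2 alpha : R, 0 < alpha &
    \forall K \near +oo, `|phi1 K - phi2 K| <= alpha * rho K.

(* Main.v *)
Require Import Defs.
From HB Require Import structures.
From mathcomp Require Import all_boot all_order all_algebra.
From mathcomp Require Import all_classical all_reals all_analysis.
From mathcomp Require Import measurable_realfun ring lra.

Import Order.TTheory GRing.Theory Num.Theory.
Import numFieldTopology.Exports numFieldNormedType.Exports.

Local Open Scope classical_set_scope.
Local Open Scope ring_scope.

(* Put s = I sqrt T, m = ln K - ln x0 - r T and y = m / s - s / 2, so that
   d1 = - y, d2 = - (y + s) and m = y s + s^2 / 2.  The Black-Scholes price is
   x0 phi(y) (M(y) - M(y + s)), with M the Mills ratio (1 - N) / phi.  The
   classical bounds on M make M(z) - 1/z nondecreasing and M(z) - 1/(4z)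
   nonincreasing, hence C(K) = phi(y) s / (y (y + s)) up to bounded factors and
   L = y^2 / 2 + ln y + ln ((y + s) / s) + O(1).  Since C(K) -> 0 forces
   y -> +oo, this gives 2 L - ln L = y^2 + e with |e| <= 2 ln ((y + s) / s) + O(1),
   whereas s = sqrt (2 m + y^2) - y exactly.  Perturbing y^2 by e changes the
   difference of square roots by O(|e| s / (y (y + s))), which is O(1 / y)
   because u ln (1 / u) is bounded on ]0, 1]; and 1 / y is of order L^(-1/2). *)

Lemma ge0_is_derive_ndecr (R : realType) (f df : R -> R) (a b : R) :
  (forall x, a <= x <= b -> is_derive x 1 f (df x)) ->
  (forall x, a <= x <= b -> 0 <= df x) -> a <= b -> f a <= f b.
Proof.
move=> fdf df0 ab.
have fd x : x \in `]a, b[ -> is_derive x 1 f (df x).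
  by rewrite in_itv/= => /andP[/ltW ax /ltW xb]; apply: fdf; rewrite ax.
have fc : {within `[a, b], continuous f}.
  apply: derivable_within_continuous => x; rewrite in_itv/= => axb.
  by have := fdf _ axb => /@ex_derive.
have [x] := MVT_segment ab fd fc.
rewrite in_itv/= => axb fba.
by rewrite -subr_ge0 fba mulr_ge0 ?df0// subr_ge0.
Qed.

(** * The standard normal density and distribution function *)

Section std_normal.
Variable R : realType.
Implicit Types x y z s : R.
Local Notation phi := (@normal_pdf R 0 1).
Local Notation N := (@std_normal_cdf R).

Lemma std_normal_pdf_gt0 x : 0 < phi x.
Proof.
by rewrite normal_pdfE ?oner_eq0// mulr_gt0 ?expR_gt0// normal_peak_gt0 ?oner_eq0.
Qed.

Lemma std_normal_pdfE x : phi x = normal_peak 1 * expR (- (x ^+ 2 / 2)).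
Proof.
rewrite normal_pdfE ?oner_eq0// /normal_fun subr0 expr1n; congr (_ * expR _).
by rewrite mulNr.
Qed.

Lemma normal_peak1_le1 : normal_peak 1 <= 1 :> R.
Proof.
rewrite /normal_peak invf_le1; last first.
  by rewrite sqrtr_gt0 mulrn_wgt0// expr1n mul1r pi_gt0.
rewrite -[leLHS]sqrtr1 ler_wsqrtr// expr1n mul1r -mulr_natr.
have := @pi_ge2 R; lra.
Qed.

Lemma std_normal_pdf_le1 x : phi x <= 1.
Proof.
exact: le_trans (normal_pdf_ub _ _ (oner_neq0 R)) normal_peak1_le1.
Qed.

Lemma is_derive_std_normal_pdf x : is_derive x 1 phi (- x * phi x).
Proof.
have -> : phi = (fun x => normal_peak 1 * expR (- (x ^+ 2 / 2))).
  by apply/funext => z; rewrite std_normal_pdfE.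
apply: is_derive_eq.
by rewrite /GRing.scale/=; field.
Qed.

Lemma is_derive_std_normal_cdf x : is_derive x 1 N (phi x).
Proof.
have ci u : (@lebesgue_measure R).-integrable `]-oo, u] (EFin \o phi).
  by apply: (integrableS _ _ (subsetT _)) => //; exact: integrable_normal_pdf.
(* The fundamental theorem of calculus differentiates at interior points only, so the integrability
   interval must end strictly beyond [x]; the length 1 is arbitrary. *)
have xx1 : x < x + 1 by rewrite ltrDl.
have cphi : {for x, continuous phi} by apply: continuous_normal_pdf; rewrite oner_eq0.
have [d1 d2] := continuous_FTC1 xx1 (ci (x + 1)) (ltNyr _) cphi.
have -> : N = (fun y => \int[lebesgue_measure]_(t in [set` `]-oo, y]]) phi t).
  by apply/funext => y; rewrite /Rintegral.
apply: DeriveDef; first exact: d1.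
by rewrite -derive1E; exact: d2.
Qed.

Lemma std_normal_cdf_ge0 x : 0 <= N x.
Proof. by rewrite /std_normal_cdf fine_ge0. Qed.

Lemma std_normal_cdf_gt0 x : 0 < N x.
Proof.
rewrite (le_lt_trans (std_normal_cdf_ge0 (x - 1)))//.
have x1x : x - 1 < x by rewrite ltrBlDr ltrDl.
have Nc : {within `[x - 1, x], continuous N}.
  apply: derivable_within_continuous => z _.
  by have := is_derive_std_normal_cdf z => /@ex_derive.
have [c _] := MVT x1x (fun z _ => is_derive_std_normal_cdf z) Nc.
rewrite subKr mulr1 => e.
by rewrite -subr_gt0 e std_normal_pdf_gt0.
Qed.

Lemma std_normal_cdf_nondecreasing x y : x <= y -> N x <= N y.
Proof.
by apply: ge0_is_derive_ndecr => z _;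
  [exact: is_derive_std_normal_cdf|exact/ltW/std_normal_pdf_gt0].
Qed.

Lemma std_normal_cdfNy (e : R) : 0 < e ->
  exists2 A, 0 < A & forall x, A <= x -> N (- x) <= e.
Proof.
move=> e0.
(* [N] is the cdf of the identity viewed as a random variable under the normal law, so the limit of
   a cdf at -oo applies. *)
have mid : (@idfun (measurableTypeR R) : measurableTypeR R -> R) \in mfun.
  by rewrite inE; exact: measurable_id.
pose X : {RV (@normal_prob R 0 1) >-> R} := mfun_Sub mid.
have /fine_cvg : cdf X @ -oo --> (0:R)%:E by exact: cvg_cdfNy0.
move=> /cvgrPdist_le /(_ _ e0) [A [Ar hA]].
exists (`|A| + 1); first by rewrite ltr_wpDl.
move=> x Ax; have /hA : - x < A.
  by rewrite ltrNl (le_lt_trans (ler_norm _))// normrN (lt_le_trans _ Ax)// ltrDl.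
rewrite /= sub0r normrN; apply: le_trans; exact: ler_norm.
Qed.

(** * Bounds on the Mills ratio and on the normalized Black-Scholes price *)

Lemma mills_lower x : 0 < x -> phi x * (x / (1 + x ^+ 2)) <= N (- x).
Proof.
move=> x0; apply/ler_addgt0Pr => e e0.
(* f is nondecreasing and its upper limit at +oo is at most 0 *)
pose f z := phi z * (z / (1 + z ^+ 2)) - N (- z).
pose df z : R := 2 * phi z / (1 + z ^+ 2) ^+ 2.
have p_gt0 z : 0 < 1 + z ^+ 2 :> R by rewrite ltr_wpDr ?sqr_ge0.
have p0 z : 1 + z ^+ 2 != 0 :> R by rewrite gt_eqF.
have fdf z : is_derive z 1 f (df z).
  have d1 := is_derive_std_normal_pdf z.
  have d2 := is_derive_std_normal_cdf (- z).
  have d3 : is_derive z 1 (fun z : R => 1 + z ^+ 2) (2 * z).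
    by apply: is_derive_eq; rewrite /GRing.scale/=; ring.
  have d4 := @is_deriveV _ (fun z : R => 1 + z ^+ 2) z _ 1 (p0 z) d3.
  apply: is_derive_eq; rewrite /df /GRing.scale/=.
  rewrite !std_normal_pdfE sqrrN.
  by field; exact: p0.
(* Since Z >= 1/e and phi <= 1, phi(Z) Z / (1 + Z^2) <= 1 / Z <= e, hence f(Z) <= e. *)
pose Z := x + e^-1.
have : f x <= f Z.
  apply: (@ge0_is_derive_ndecr _ f df).
  - move=> z _; rewrite /df divr_ge0 ?sqr_ge0// mulr_ge0//.
    exact/ltW/std_normal_pdf_gt0.
  - by rewrite lerDl invr_ge0 ltW.
have eZ : e^-1 <= Z by rewrite lerDr ltW.
have Z0 : 0 < Z by rewrite (lt_le_trans _ eZ)// invr_gt0.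
have : phi Z * (Z / (1 + Z ^+ 2)) <= e.
  have : Z / (1 + Z ^+ 2) <= e.
    rewrite ler_pdivrMr//.
    have := ler_wpM2l (ltW e0) eZ; rewrite divff ?gt_eqF// => h.
    have := ler_wpM2r (ltW Z0) h; nra.
  move=> h; rewrite -[leRHS]mul1r ler_pM ?std_normal_pdf_le1//.
    exact/ltW/std_normal_pdf_gt0.
  by rewrite divr_ge0// ltW.
have := std_normal_cdf_ge0 (- Z).
rewrite /f; lra.
Qed.

(** The quotient is the third convergent of the continued fraction of the Mills ratio. The gap [f]
    is nondecreasing and bounded above by N(- z), which tends to 0, so it is nonpositive. The cruder
    bound M(z) <= 1/z would give only 1 - z M(z) >= 0, whereas [mills_diff_lower] needs a lower
    bound of order 1/z^2. *)
Lemma mills_upper x : 0 < x ->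
  N (- x) <= phi x * ((x ^+ 2 + 2) / (x ^+ 3 + 3 * x)).
Proof.
move=> x0; apply/ler_addgt0Pr => e e0.
pose f z := N (- z) - phi z * ((z ^+ 2 + 2) / (z ^+ 3 + 3 * z)).
pose df z : R := 6 * phi z / (z ^+ 3 + 3 * z) ^+ 2.
have p_gt0 z : 0 < z -> 0 < z ^+ 3 + 3 * z :> R.
  by move=> z0; rewrite addr_gt0 ?exprn_gt0// mulr_gt0.
have fdf z : 0 < z -> is_derive z 1 f (df z).
  move=> /p_gt0/lt0r_neq0 p0.
  have d1 := is_derive_std_normal_pdf z.
  have d2 := is_derive_std_normal_cdf (- z).
  have d3 : is_derive z 1 (fun z : R => z ^+ 3 + 3 * z) (3 * z ^+ 2 + 3).
    by apply: is_derive_eq; rewrite /GRing.scale/=; ring.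
  have d4 := @is_deriveV _ (fun z : R => z ^+ 3 + 3 * z) z _ 1 p0 d3.
  apply: is_derive_eq; rewrite /df /GRing.scale/=.
  rewrite !std_normal_pdfE sqrrN.
  by field.
have [A A0 hA] := std_normal_cdfNy _ e0.
pose Z := x + A.
have : f x <= f Z.
  apply: (@ge0_is_derive_ndecr _ f df).
  - by move=> z /andP[xz _]; apply: fdf; exact: lt_le_trans xz.
  - move=> z _; rewrite /df divr_ge0 ?sqr_ge0// mulr_ge0//.
    exact/ltW/std_normal_pdf_gt0.
  - by rewrite lerDl ltW.
have /hA : A <= Z by rewrite lerDr ltW.
have Z0 : 0 < Z by rewrite addr_gt0.
have : 0 <= phi Z * ((Z ^+ 2 + 2) / (Z ^+ 3 + 3 * Z)).
  rewrite mulr_ge0 ?(ltW (std_normal_pdf_gt0 _))// divr_ge0 ?(ltW (p_gt0 _ _))//.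
  by rewrite addr_ge0// sqr_ge0.
rewrite /f; lra.
Qed.

Local Notation mills z := (N (- z) / phi z).

Lemma is_derive_mills z : is_derive z 1 (fun z => mills z) (z * mills z - 1).
Proof.
have p0 : phi z != 0 by rewrite gt_eqF// std_normal_pdf_gt0.
have d1 := is_derive_std_normal_pdf z.
have d2 := is_derive_std_normal_cdf (- z).
have d3 := @is_deriveV _ phi z _ 1 p0 d1.
apply: is_derive_eq; rewrite /GRing.scale/=.
have -> : phi (- z) = phi z by rewrite !std_normal_pdfE sqrrN.
by field.
Qed.

(** M' = z M - 1, and [mills_lower] gives z M - 1 >= - 1 / (1 + z^2) >= - 1 / z^2. *)
Lemma mills_diff_upper y s : 0 < y -> 0 <= s ->
  mills y - mills (y + s) <= y^-1 - (y + s)^-1.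
Proof.
move=> y0 s0.
suff : mills y - y^-1 <= mills (y + s) - (y + s)^-1 by lra.
pose df z : R := z * mills z - 1 + (z ^+ 2)^-1.
apply: (@ge0_is_derive_ndecr _ (fun z => mills z - z^-1) df).
- move=> z /andP[yz _].
  have z0 : z != 0 by rewrite gt_eqF// (lt_le_trans y0).
  have d1 := is_derive_mills z.
  have d2 := @is_deriveV _ (id : R -> R) z _ 1 z0 (is_derive_id _ _).
  apply: is_derive_eq; rewrite /df /GRing.scale/=.
  by field; rewrite z0 gt_eqF// std_normal_pdf_gt0.
- move=> z /andP[yz _]; have z0 : 0 < z by exact: lt_le_trans yz.
  have p0 := std_normal_pdf_gt0 z.
  have : z / (1 + z ^+ 2) <= mills z.
    by rewrite ler_pdivlMr// mulrC mills_lower.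
  move=> /(ler_wpM2l (ltW z0)).
  have q0 : 0 < 1 + z ^+ 2 by rewrite ltr_wpDr ?sqr_ge0.
  have -> : z * (z / (1 + z ^+ 2)) = 1 - (1 + z ^+ 2)^-1.
    by field; rewrite gt_eqF.
  have : (1 + z ^+ 2)^-1 <= (z ^+ 2)^-1.
    by rewrite lef_pV2 ?posrE ?exprn_gt0// lerDr.
  rewrite /df; lra.
- by rewrite lerDl.
Qed.

(** By [mills_upper], 1 - z M >= 1 / (z^2 + 3), and this dominates 1 / (4 z^2) as soon as z >= 1;
    hence the factor 1/4 and the hypothesis on [y]. *)
Lemma mills_diff_lower y s : 1 <= y -> 0 <= s ->
  4^-1 * (y^-1 - (y + s)^-1) <= mills y - mills (y + s).
Proof.
move=> y1 s0; have y0 : 0 < y by exact: lt_le_trans y1.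
suff : 4^-1 * y^-1 - mills y <= 4^-1 * (y + s)^-1 - mills (y + s) by lra.
pose df z : R := - 4^-1 * (z ^+ 2)^-1 - (z * mills z - 1).
apply: (@ge0_is_derive_ndecr _ (fun z => 4^-1 * z^-1 - mills z) df).
- move=> z /andP[yz _].
  have z0 : z != 0 by rewrite gt_eqF// (lt_le_trans y0).
  have d1 := is_derive_mills z.
  have d2 := @is_deriveV _ (id : R -> R) z _ 1 z0 (is_derive_id _ _).
  apply: is_derive_eq; rewrite /df /GRing.scale/=.
  by field; rewrite z0 gt_eqF// std_normal_pdf_gt0.
- move=> z /andP[yz _]; have z1 : 1 <= z by exact: le_trans yz.
  have z0 : 0 < z by exact: lt_le_trans yz.
  have p0 := std_normal_pdf_gt0 z.
  have : mills z <= (z ^+ 2 + 2) / (z ^+ 3 + 3 * z).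
    by rewrite ler_pdivrMr// mulrC mills_upper.
  move=> /(ler_wpM2l (ltW z0)).
  have q0 : 0 < z ^+ 2 + 3 by rewrite ltr_wpDl ?sqr_ge0.
  have -> : z * ((z ^+ 2 + 2) / (z ^+ 3 + 3 * z)) = 1 - (z ^+ 2 + 3)^-1.
    field; rewrite gt_eqF//= gt_eqF//.
    by rewrite addr_gt0 ?exprn_gt0// mulr_gt0.
  have : 4^-1 * (z ^+ 2)^-1 <= (z ^+ 2 + 3)^-1.
    rewrite -invfM lef_pV2 ?posrE ?mulr_gt0 ?exprn_gt0//.
    have : 1 <= z ^+ 2 by rewrite exprn_ege1.
    lra.
  rewrite /df; lra.
- by rewrite lerDl.
Qed.

(* The Black-Scholes price divided by [x0] when [d1 = - y], [d2 = - (y + s)]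
   and [K e^(-rT) / x0 = e^(y s + s^2 / 2)]. *)
Definition bs_normalized y s :=
  N (- y) - expR (y * s + s ^+ 2 / 2) * N (- (y + s)).

(** Completing the square, the weight e^(y s + s^2 / 2) equals phi(y) / phi(y + s), so phi(y)
    factors out of both terms. *)
Lemma bs_normalizedE y s : bs_normalized y s = phi y * (mills y - mills (y + s)).
Proof.
have p0 := std_normal_pdf_gt0 y; have p1 := std_normal_pdf_gt0 (y + s).
have -> : phi y = expR (y * s + s ^+ 2 / 2) * phi (y + s).
  by rewrite !std_normal_pdfE mulrCA -expRD; congr (_ * expR _); field.
rewrite /bs_normalized; field; by rewrite !gt_eqF// expR_gt0.
Qed.

Lemma bs_normalized_upper y s : 0 < y -> 0 <= s ->
  bs_normalized y s <= phi y * (s / (y * (y + s))).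
Proof.
move=> y0 s0; rewrite bs_normalizedE ler_wpM2l//.
  exact/ltW/std_normal_pdf_gt0.
rewrite (le_trans (mills_diff_upper _ _ y0 s0))// le_eqVlt; apply/orP; left.
by apply/eqP; field; rewrite !gt_eqF// ltr_wpDr.
Qed.

Lemma bs_normalized_lower y s : 1 <= y -> 0 <= s ->
  4^-1 * (phi y * (s / (y * (y + s)))) <= bs_normalized y s.
Proof.
move=> y1 s0; have y0 : 0 < y by exact: lt_le_trans y1.
rewrite bs_normalizedE mulrCA ler_wpM2l//.
  exact/ltW/std_normal_pdf_gt0.
rewrite (le_trans _ (mills_diff_lower _ _ y1 s0))// le_eqVlt; apply/orP; left.
by apply/eqP; field; rewrite !gt_eqF// ltr_wpDr.
Qed.

(** The subtracted term is phi(y) M(y + s), with phi <= 1 and M(z) <= 1/z. As the Mills bound is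
    taken at y + s, [y] itself may be zero or negative. *)
Lemma bs_normalized_ge_cdf y s : 0 < y + s ->
  N (- y) - (y + s)^-1 <= bs_normalized y s.
Proof.
move=> ys0; rewrite /bs_normalized lerB//.
have p0 := std_normal_pdf_gt0 (y + s).
have : N (- (y + s)) <= phi (y + s) * (y + s)^-1.
  apply: le_trans (mills_upper _ ys0) _; rewrite ler_wpM2l ?(ltW p0)//.
  set z := y + s.
  have z3 : 0 < z ^+ 3 + 3 * z by rewrite addr_gt0 ?exprn_gt0// mulr_gt0.
  rewrite ler_pdivrMr//.
  have -> : z^-1 * (z ^+ 3 + 3 * z) = z ^+ 2 + 3 by field; rewrite gt_eqF.
  lra.
move=> /(ler_wpM2l (expR_ge0 (y * s + s ^+ 2 / 2))) /le_trans; apply.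
rewrite mulrA.
have -> : expR (y * s + s ^+ 2 / 2) * phi (y + s) = phi y.
  by rewrite !std_normal_pdfE mulrCA -expRD; congr (_ * expR _); field.
by rewrite ler_piMl ?std_normal_pdf_le1// invr_ge0 ltW.
Qed.

Lemma bs_normalized_le_cdf y s : bs_normalized y s <= N (- y).
Proof.
by rewrite /bs_normalized gerBl mulr_ge0 ?expR_ge0// std_normal_cdf_ge0.
Qed.

End std_normal.

Arguments bs_normalized {R}.

(** * Perturbation of a difference of square roots *)

Section sqrt_asymptotics.
Variable R : realType.
Implicit Types y s L c e : R.

(** For e = c = 0 the difference of roots is exactly [s]. The perturbation [e] is common to both
    roots, so its effect partly cancels and keeps the factor s / (y + s), which later compensates
    for an [e] of size ln ((y + s) / s). *)
Lemma sqrt_increment_stable y s e c : 0 < y -> 0 < s ->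
  `|e| <= y ^+ 2 / 4 -> `|c| <= y ^+ 2 / 4 ->
  `|s - (Num.sqrt ((y + s) ^+ 2 + e + c) - Num.sqrt (y ^+ 2 + e))|
    <= (2 * `|c| + 5 * (`|e| * (s / (y + s)))) / y.
Proof.
move=> y0 s0 he hc.
set b := Num.sqrt _; set a := Num.sqrt _.
have [e1 e2] : - (y ^+ 2 / 4) <= e /\ e <= y ^+ 2 / 4 by apply/andP; rewrite -ler_norml.
have [c1 c2] : - (y ^+ 2 / 4) <= c /\ c <= y ^+ 2 / 4 by apply/andP; rewrite -ler_norml.
have y2 : 0 < y ^+ 2 by rewrite exprn_gt0.
have b2 : b ^+ 2 = (y + s) ^+ 2 + e + c by rewrite sqr_sqrtr//; nra.
have a2 : a ^+ 2 = y ^+ 2 + e by rewrite sqr_sqrtr//; nra.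
have a0 : 0 <= a by exact: sqrtr_ge0.
have b0 : 0 <= b by exact: sqrtr_ge0.
clearbody a b.
have ys0 : 0 < y + s by rewrite addr_gt0.
have hb : (y + s) / 2 <= b by rewrite -ler_sqr ?nnegrE ?divr_ge0 ?(ltW ys0)// b2; nra.
have ba0 : 0 < b + a by lra.
(* From b^2 - a^2 = s (2 y + s) + c and b + a >= (y + s) / 2, the increment b - a is of order [s],
   up to a term in [c]. *)
have hba : `|b - a + s| <= 5 * s + 2 * `|c| / (y + s).
  have -> : b - a + s = (s * (2 * y + s) + c) / (b + a) + s.
    have <- : (b - a) * (b + a) = s * (2 * y + s) + c.
      by rewrite -subr_sqr b2 a2; ring.
    by rewrite mulfK// gt_eqF.
  rewrite (le_trans (ler_normD _ _))// (gtr0_norm s0).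
  suff : `|(s * (2 * y + s) + c) / (b + a)| <= 4 * s + 2 * `|c| / (y + s) by lra.
  rewrite normrM normfV (gtr0_norm ba0) ler_pdivrMr//.
  have n1 : `|s * (2 * y + s) + c| <= s * (2 * y + s) + `|c|.
    by rewrite (le_trans (ler_normD _ _))// lerD2r ger0_norm//; nra.
  apply: (le_trans n1).
  have -> : 4 * s + 2 * `|c| / (y + s) = (4 * s * (y + s) + 2 * `|c|) / (y + s).
    by field; rewrite gt_eqF.
  have h : (y + s) / 2 <= b + a by lra.
  have k0 : 0 <= (4 * s * (y + s) + 2 * `|c|) / (y + s).
    rewrite divr_ge0 ?(ltW ys0)// addr_ge0// !mulr_ge0// ltW//.
  apply: le_trans (ler_wpM2l k0 h).
  have -> : (4 * s * (y + s) + 2 * `|c|) / (y + s) * ((y + s) / 2) =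
      2 * s * (y + s) + `|c| by field; rewrite gt_eqF.
  rewrite lerD2r; nra.
(* By conjugates, b - (y + s) = (e + c) / (b + y + s) and a - y = e / (a + y); subtracting the two
   terms in [e] produces the factor b - a + s. *)
have -> : s - (b - a) = - (c / (b + (y + s)) -
                       e * (b - a + s) / ((b + (y + s)) * (a + y))).
  have -> : c = b ^+ 2 - (y + s) ^+ 2 - (a ^+ 2 - y ^+ 2) by rewrite b2 a2; ring.
  have -> : e = a ^+ 2 - y ^+ 2 by rewrite a2; ring.
  by field; rewrite !gt_eqF//; lra.
rewrite normrN (le_trans (ler_normB _ _))//.
have B0 : 0 < b + (y + s) by lra.
have A0 : 0 < a + y by lra.
have iy : y^-1 >= (b + (y + s))^-1 by rewrite lef_pV2 ?posrE//; lra.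
have iy' : y^-1 >= (a + y)^-1 by rewrite lef_pV2 ?posrE//; lra.
have iys : (y + s)^-1 >= (b + (y + s))^-1 by rewrite lef_pV2 ?posrE//; lra.
have t1 : `|c / (b + (y + s))| <= `|c| / y.
  by rewrite normrM normfV (gtr0_norm B0) ler_wpM2l.
have t2 : `|e * (b - a + s) / ((b + (y + s)) * (a + y))| <=
    `|e| * (5 * s + 2 * `|c| / (y + s)) / ((y + s) * y).
  rewrite normrM normfV (gtr0_norm (mulr_gt0 B0 A0)) normrM.
  apply: ler_pM => //; first by rewrite invr_ge0 mulr_ge0// ltW.
    by rewrite ler_wpM2l.
  by rewrite !invfM ler_pM ?invr_ge0 ?(ltW B0) ?(ltW A0).
rewrite (le_trans (lerD t1 t2))//.
have -> : `|c| / y + `|e| * (5 * s + 2 * `|c| / (y + s)) / ((y + s) * y) =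
    (`|c| + 5 * (`|e| * (s / (y + s))) + `|c| * (2 * `|e| / (y + s) ^+ 2)) / y.
  by field; rewrite !gt_eqF.
rewrite ler_wpM2r ?invr_ge0 ?(ltW y0)//.
(* The cross term in |c| |e| is thus absorbed by a second copy of |c|. *)
have : 2 * `|e| / (y + s) ^+ 2 <= 1.
  by rewrite ler_pdivrMr ?exprn_gt0// mul1r; nra.
move=> /(ler_wpM2l (normr_ge0 c)); lra.
Qed.

(** With m = y s + s^2 / 2, the shift [c0] turns m into ln K, and [c1] bounds the error in the
    expansion of L. The hypothesis m >= 1 keeps [s] above 1 / (2 y), so that ln ((y + s) / s) is at
    most of order ln y. *)
Lemma sqrt_asymptotics (c0 c1 : R) : 0 <= c1 -> exists A alpha : R,
  [/\ 0 < A, 0 < alpha & forall y s L, A <= y -> 0 < s ->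
    1 <= y * s + s ^+ 2 / 2 ->
    `|L - (y ^+ 2 / 2 + ln y + ln ((y + s) / s))| <= c1 ->
    0 < L /\
    `|s - (Num.sqrt (2 * (y * s + s ^+ 2 / 2 + c0) + 2 * L - ln L)
           - Num.sqrt (2 * L - ln L))| <= alpha * L `^ (- (1 / 2))].
Proof.
move=> c10; pose c2 := 2 * c1 + 4.
(* The threshold makes y^2 dominate all the logarithms and constants below. The second witness is 2
   |c| + 5 |e| s / (y + s) with c = 2 [c0] and the bound 2 + [c2] on |e| s / (y + s). *)
exists (20 + 4 * c1 + 2 * `|c0|), (4 * `|c0| + 5 * (2 + c2)).
have n0 := normr_ge0 c0.
split; [lra|rewrite /c2; lra|] => y s L Ay s0 m1 /ler_normlP[].
have y1 : 20 <= y by lra.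
have y0 : 0 < y by lra.
have ys0 : 0 < y + s by lra.
set l := ln y; set u := ln ((y + s) / s) => hL1 hL2.
have u_gt1 : 1 < (y + s) / s by rewrite ltr_pdivlMr// mul1r ltrDr.
have u0 : 0 <= u by rewrite ln_ge0// ltW.
have l0 : 0 <= l by rewrite ln_ge0//; lra.
have ly : l <= y by exact/ltW/ln_sublinear.
have ln4 (x : R) : 0 < x -> ln (4 * x) <= 4 + ln x.
  by move=> x0; rewrite lnM ?posrE// lerD2r; apply/ltW/ln_sublinear.
have ly2 : ln (y ^+ 2) = 2 * l by rewrite lnXn// mulr_natl.
have uy : u <= 4 + 2 * l.
  rewrite -ly2; apply: (le_trans _ (ln4 _ _)); last by rewrite exprn_gt0.
  rewrite ler_ln ?posrE; [|exact: lt_trans u_gt1|by rewrite mulr_gt0 ?exprn_gt0].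
  rewrite ler_pdivrMr//.
  have ys : 1 <= 2 * y * s.
    rewrite leNgt; apply/negP => ys1; have s1 : s <= 1 by nra.
    nra.
  nra.
have y20y : 20 * y <= y ^+ 2 by rewrite expr2 ler_pM2r.
have L1 : y ^+ 2 / 4 <= L by lra.
have L2 : L <= y ^+ 2 by lra.
have y20 : 0 < y ^+ 2 by rewrite exprn_gt0.
have L0 : 0 < L by lra.
have lnL1 : ln L <= 2 * l by rewrite -ly2 ler_ln ?posrE.
have lnL2 : 2 * l <= 4 + ln L.
  rewrite -ly2; apply: (le_trans _ (ln4 _ _)) => //.
  by rewrite ler_ln ?posrE ?mulr_gt0//; lra.
split=> //.
pose e := 2 * L - ln L - y ^+ 2.
(* Since y^2 / 4 <= L <= y^2, the terms 2 ln y and ln L differ by at most ln 4 <= 4; this is the 4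
   in [c2], and 2 [c1] comes from doubling L. *)
have e1 : `|e| <= 2 * u + c2 by rewrite ler_norml /e /c2; lra.
have e2 : `|e| <= y ^+ 2 / 4 by apply: (le_trans e1); rewrite /c2; lra.
have hc0 : `|2 * c0| <= y ^+ 2 / 4 by rewrite normrM ger0_norm//; lra.
have := sqrt_increment_stable y s e (2 * c0) y0 s0 e2 hc0.
rewrite /e (_ : (y + s) ^+ 2 + _ + _ =
  2 * (y * s + s ^+ 2 / 2 + c0) + 2 * L - ln L); last by field.
rewrite (_ : y ^+ 2 + _ = 2 * L - ln L); last by ring.
rewrite -/e => /le_trans; apply.
(* The logarithm [u] is at most (y + s) / s, so the factor s / (y + s) brings it below 1. *)
have eu : `|e| * (s / (y + s)) <= 2 + c2.
  have v0 : 0 <= s / (y + s) by rewrite divr_ge0 ?ltW.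
  apply: (le_trans (ler_wpM2r v0 e1)).
  have v1 : s / (y + s) <= 1 by rewrite ler_pdivrMr// mul1r; lra.
  have : u * (s / (y + s)) <= 1.
    have /(ler_wpM2r v0) : u <= (y + s) / s by apply/ltW/ln_sublinear; lra.
    suff -> : (y + s) / s * (s / (y + s)) = 1 by [].
    by field; rewrite !gt_eqF.
  have : 0 <= c2 by rewrite /c2; lra.
  nra.
rewrite ler_pM ?invr_ge0 ?(ltW y0)//.
- by rewrite addr_ge0 ?mulr_ge0// ?invr_ge0 ltW.
- by rewrite normrM ger0_norm//; lra.
(* L <= y^2 converts 1 / y into L^(-1/2). *)
- rewrite powRN mul1r powR12_sqrt ?(ltW L0)// lef_pV2 ?posrE ?sqrtr_gt0//.
  by rewrite -(ger0_norm (ltW y0)) -sqrtr_sqr ler_wsqrtr.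
Qed.

End sqrt_asymptotics.

(** * Implied volatility: existence and expansion *)

Section implied_volatility.
Variable R : realType.
Implicit Types r x T K m y s v sigma : R.
Local Notation phi := (@normal_pdf R 0 1).
Local Notation N := (@std_normal_cdf R).

(** The upper and lower bounds on the price differ by a factor 4; the other constant is the peak of
    phi. *)
Lemma ln_bs_normalized : exists2 c : R, 0 <= c & forall y s, 1 <= y -> 0 < s ->
  0 < bs_normalized y s /\
  `|- ln (bs_normalized y s) - (y ^+ 2 / 2 + ln y + ln ((y + s) / s))| <= c.
Proof.
have peak0 : 0 < normal_peak 1 :> R by rewrite normal_peak_gt0// oner_eq0.
exists (`|ln (normal_peak 1 : R)| + ln 4); first by rewrite addr_ge0// ln_ge0//; lra.
move=> y s y1 s0; have y0 : 0 < y by lra.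
have ys0 : 0 < y + s by lra.
have := bs_normalized_lower _ _ _ y1 (ltW s0).
have := bs_normalized_upper _ _ _ y0 (ltW s0).
have p0 := std_normal_pdf_gt0 _ y.
have q0 : 0 < s / (y * (y + s)) by rewrite divr_gt0// mulr_gt0.
set D := phi y * _; have D0 : 0 < D by rewrite mulr_gt0.
set b := bs_normalized y s => ub lb.
have b0 : 0 < b by apply: lt_le_trans lb; rewrite mulr_gt0.
have lnD : ln D = ln (normal_peak 1) - (y ^+ 2 / 2 + ln y + ln ((y + s) / s)).
  have : 0 < (y + s) / s by rewrite divr_gt0.
  rewrite /D (_ : s / _ = (y * ((y + s) / s))^-1); last by field; rewrite !gt_eqF.
  move: ((y + s) / s) => w w0.
  rewrite lnM ?posrE ?invr_gt0 ?mulr_gt0// lnV ?posrE ?mulr_gt0//.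
  rewrite (lnM (x := y))// std_normal_pdfE lnM ?posrE ?expR_gt0// expRK; ring.
have l1 : ln b <= ln D by rewrite ler_ln.
have l2 : ln D - ln 4 <= ln b.
  rewrite -ln_div ?posrE// mulrC ler_ln// posrE mulr_gt0// invr_gt0.
split=> //; have := ler_norm (ln (normal_peak 1 : R)).
have := ler_norm (- ln (normal_peak 1 : R)); rewrite normrN.
have : 0 <= ln (4 : R) by rewrite ln_ge0//; lra.
rewrite ler_norml; lra.
Qed.

Lemma black_scholesE r (x0 : R) T K sigma : 0 < x0 -> 0 < T -> 0 < K -> 0 < sigma ->
  let m := ln K - ln x0 - r * T in let s := sigma * Num.sqrt T in
  black_scholes r x0 T K sigma = x0 * bs_normalized (m / s - s / 2) s.
Proof.
move=> x00 T0 K0 sigma0 m s; rewrite /black_scholes gt_eqF//.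
have sT0 : 0 < Num.sqrt T by rewrite sqrtr_gt0.
have s0 : 0 < s by rewrite mulr_gt0.
have s2 : s ^+ 2 = sigma ^+ 2 * T by rewrite exprMn sqr_sqrtr// ltW.
have d1 : bs_d1 r x0 T K sigma = - (m / s - s / 2).
  rewrite /bs_d1 -/s.
  have -> : (ln x0 - ln K + (r + sigma ^+ 2 / 2) * T) = - m + s ^+ 2 / 2.
    by rewrite s2 /m; field.
  by field; rewrite gt_eqF.
rewrite /bs_d2 d1 -/s -opprD /bs_normalized mulrBr mulrA; congr (_ - _ * _).
have -> : (m / s - s / 2) * s + s ^+ 2 / 2 = ln K - ln x0 + - (r * T).
  by rewrite /m; field; rewrite gt_eqF.
rewrite expRD expRB !lnK ?posrE//; field; by rewrite gt_eqF.
Qed.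

(** Intermediate values in [s]: for small [s] the variable y = m / s - s / 2 is large and the price
    is at most N(- y); at s = sqrt(2 m) one has y = 0, where the price is at least N(0) - 1 / s. *)
Lemma bs_normalized_surjective m v : 1 <= m -> 0 < v ->
  v <= N 0 - (Num.sqrt (2 * m))^-1 ->
  exists2 s, 0 < s & bs_normalized (m / s - s / 2) s = v.
Proof.
move=> m1 v0 hv; have m0 : 0 < m by lra.
have [A A0 hA] := std_normal_cdfNy _ _ v0.
set b := Num.sqrt (2 * m) in hv.
have b2 : b ^+ 2 = 2 * m by rewrite sqr_sqrtr//; lra.
have b0 : 0 < b by rewrite sqrtr_gt0; lra.
(* This gives m / a = A + m + 1 and a <= 1, hence m / a - a / 2 >= A. *)
pose a := m / (A + m + 1).
have Am0 : 0 < A + m + 1 by lra.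
have a0 : 0 < a by rewrite divr_gt0.
have a1 : a <= 1 by rewrite ler_pdivrMr//; lra.
have ab : a <= b.
  apply: (le_trans a1); rewrite -(@ler_sqr R) ?nnegrE ?(ltW b0)// b2; lra.
pose g s := bs_normalized (m / s - s / 2) s.
have gc : {within `[a, b], continuous g}.
  apply: derivable_within_continuous => s; rewrite in_itv/= => /andP[sa _].
  have s0 : s != 0 by rewrite gt_eqF//; exact: lt_le_trans sa.
  have d1 := @is_deriveV _ (id : R -> R) s _ 1 s0 (is_derive_id _ _).
  have d2 := is_derive_std_normal_cdf _ (- (m / s - s / 2)).
  have d3 := is_derive_std_normal_cdf _ (- (m / s - s / 2 + s)).
  exact: ex_derive.
have gav : g a <= v.
  apply: (le_trans (bs_normalized_le_cdf _ _ _)); apply: hA.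
  have -> : m / a = A + m + 1 by rewrite /a; field; rewrite !gt_eqF.
  lra.
have gvb : v <= g b.
  rewrite /g.
  have -> : m / b - b / 2 = 0.
    have -> : m = b ^+ 2 / 2 by rewrite b2; field.
    by field; rewrite gt_eqF.
  apply: (le_trans hv); have := bs_normalized_ge_cdf R 0 b.
  by rewrite add0r oppr0; exact.
have [|s] := IVT ab gc (v := v).
  by rewrite ge_min gav le_max gvb orbT.
rewrite in_itv/= => /andP[sa _] gs; exists s => //; exact: lt_le_trans sa.
Qed.

(** This is how a small price forces [y] to be large. If y < A, then N(- y) >= N(- A), while (y +
    s)^2 = 2 m + y^2 gives 1 / (y + s) <= 1 / sqrt(2 m). *)
Lemma bs_normalized_small m s A : 0 < m -> 0 < s ->
  bs_normalized (m / s - s / 2) s < N (- A) - (Num.sqrt (2 * m))^-1 ->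
  A <= m / s - s / 2.
Proof.
move=> m0 s0; apply: contraPT; rewrite -ltNge => yA; apply/negP; rewrite -leNgt.
set y := m / s - s / 2 in yA *.
have ysE : y + s = m / s + s / 2 by rewrite /y; field; rewrite gt_eqF.
have ys0 : 0 < y + s by rewrite ysE addr_gt0// divr_gt0.
apply: le_trans (bs_normalized_ge_cdf _ _ _ ys0).
rewrite lerB//; first by rewrite std_normal_cdf_nondecreasing// lerN2 ltW.
rewrite lef_pV2 ?posrE// ?sqrtr_gt0 ?mulr_gt0//.
rewrite -(ger0_norm (ltW ys0)) -sqrtr_sqr ler_wsqrtr// ysE.
rewrite (_ : 2 * m = (m / s + s / 2) ^+ 2 - (m / s - s / 2) ^+ 2).
  by rewrite gerBl sqr_ge0.
by field; rewrite gt_eqF.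
Qed.

Lemma implied_volP (r x0 : R) (C : R -> R -> R) T K :
  0 < x0 -> 0 < T -> 0 < K -> let m := ln K - ln x0 - r * T in
  1 <= m -> 0 < C T K -> C T K / x0 <= N 0 - (Num.sqrt (2 * m))^-1 ->
  let s := implied_vol r x0 C T K * Num.sqrt T in
  0 < s /\ x0 * bs_normalized (m / s - s / 2) s = C T K.
Proof.
move=> x00 T0 K0 m m1 C0 hC.
have sT0 : 0 < Num.sqrt T by rewrite sqrtr_gt0.
have Cx0 : 0 < C T K / x0 by rewrite divr_gt0.
have [s s0 hs] := bs_normalized_surjective _ _ m1 Cx0 hC.
have ex : [set sigma | 0 <= sigma /\ black_scholes r x0 T K sigma = C T K]
    (s / Num.sqrt T).
  split; first by rewrite divr_ge0 ?ltW.
  rewrite black_scholesE ?divr_gt0// divfK ?gt_eqF// hs mulrC divfK// gt_eqF//.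
have := xgetPex 0 (ex_intro _ _ ex); rewrite -/(implied_vol r x0 C T K).
set I := implied_vol r x0 C T K => -[I0 hI].
(* At volatility 0 the price is (x0 - K e^(-rT))^+, which vanishes because m > 0, contradicting C >
   0. *)
have I_gt0 : 0 < I.
  rewrite lt_neqAle I0 andbT; apply/negP => /eqP I_eq0; move: hI.
  rewrite /black_scholes -I_eq0 eqxx max_r => [C_eq0|].
    by move: C0; rewrite -C_eq0 ltxx.
  rewrite subr_le0 -ler_ln ?posrE ?mulr_gt0 ?expR_gt0// lnM ?posrE ?expR_gt0//.
  rewrite expRK; move: m1; rewrite /m; lra.
split; first by rewrite mulr_gt0.
by rewrite -hI black_scholesE.
Qed.

(** The estimate is deterministic: the constants depend on [r], [x0] and [T] only and are uniform
    over price functions [C]. *)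
Lemma implied_vol_asymptotics (r x0 T : R) : 0 < x0 -> 0 < T ->
  exists e M alpha : R, [/\ 0 < e, 0 < alpha &
    forall (C : R -> R -> R) K, 0 < K -> M <= ln K -> 0 < C T K <= e ->
    let L := ln (1 / C T K) in
    0 < L /\
    `|implied_vol r x0 C T K - 1 / Num.sqrt T *
       (Num.sqrt (2 * ln K + 2 * L - ln L) - Num.sqrt (2 * L - ln L))|
     <= alpha * L `^ (- (1 / 2))].
Proof.
move=> x00 T0.
have sT0 : 0 < Num.sqrt T by rewrite sqrtr_gt0.
have [c2 c20 hc2] := ln_bs_normalized.
have c1_ge0 : 0 <= c2 + `|ln x0| by rewrite addr_ge0.
have [A [alpha [A0 alpha0 hA]]] := sqrt_asymptotics R (ln x0 + r * T) _ c1_ge0.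
(* This threshold exceeds both [A] and 1, as [sqrt_asymptotics] and [ln_bs_normalized] require. *)
pose A1 := A + 1.
have NA0 := std_normal_cdf_gt0 R (- A1).
have NA_le : N (- A1) <= N 0.
  by rewrite std_normal_cdf_nondecreasing// oppr_le0 /A1; lra.
pose b := 4 / N (- A1).
have b0 : 0 < b by rewrite divr_gt0.
(* Then C / x0 <= N(- A1) / 2, while the bound on ln K gives m >= 1 and 1 / sqrt(2 m) <= 1 / b = N(-
   A1) / 4. Hence C / x0 < N(- A1) - 1 / sqrt(2 m), which yields y >= [A1]. *)
exists (x0 * (N (- A1) / 2)), (ln x0 + r * T + 1 + b ^+ 2), (alpha / Num.sqrt T).
split; [by rewrite mulr_gt0// divr_gt0|by rewrite divr_gt0|].
move=> C K K0 MK /andP[C0 Ce] L.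
pose m := ln K - ln x0 - r * T.
have m1 : 1 <= m by rewrite /m; have := sqr_ge0 b; lra.
have mb : b ^+ 2 <= 2 * m by rewrite /m; have := sqr_ge0 b; lra.
have m0 : 0 < m by lra.
have sm : (Num.sqrt (2 * m))^-1 <= N (- A1) / 4.
  rewrite -[leRHS]invrK invf_div -/b lef_pV2 ?posrE// ?sqrtr_gt0 ?mulr_gt0//.
  by rewrite -(ger0_norm (ltW b0)) -sqrtr_sqr ler_wsqrtr.
have Cx : C T K / x0 <= N (- A1) / 2 by rewrite ler_pdivrMr// mulrC.
have hC : C T K / x0 <= N 0 - (Num.sqrt (2 * m))^-1 by lra.
have [] := implied_volP _ _ _ _ _ x00 T0 K0 m1 C0 hC.
set s := _ * Num.sqrt T => s0 hs.
set y := m / s - s / 2 in hs.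
have bE : bs_normalized y s = C T K / x0 by rewrite -hs mulrAC mulfV ?mul1r// gt_eqF.
have yA1 : A1 <= y by apply: bs_normalized_small => //; rewrite -/y bE; lra.
have y1 : 1 <= y by apply: le_trans yA1; rewrite /A1; lra.
have [b_gt0 hb] := hc2 y s y1 s0.
have mE : y * s + s ^+ 2 / 2 = m by rewrite /y; field; rewrite gt_eqF.
have hL : `|L - (y ^+ 2 / 2 + ln y + ln ((y + s) / s))| <= c2 + `|ln x0|.
  have -> : L = - ln (bs_normalized y s) - ln x0.
    by rewrite bE /L div1r lnV ?posrE// ln_div ?posrE//; ring.
  by rewrite addrAC (le_trans (ler_normB _ _))// lerD2r.
have m1' : 1 <= y * s + s ^+ 2 / 2 by rewrite mE.
have yA : A <= y by apply: le_trans yA1; rewrite /A1; lra.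
have [L0 hI] := hA _ _ _ yA s0 m1' hL.
split=> //.
have kE : m + (ln x0 + r * T) = ln K by rewrite /m; ring.
rewrite mE kE in hI.
rewrite [leRHS]mulrAC ler_pdivlMr// mulrC.
rewrite -{1}(ger0_norm (ltW sT0)) -normrM.
suff -> : Num.sqrt T * (implied_vol r x0 C T K - 1 / Num.sqrt T *
       (Num.sqrt (2 * ln K + 2 * L - ln L) - Num.sqrt (2 * L - ln L))) =
  s - (Num.sqrt (2 * ln K + 2 * L - ln L) - Num.sqrt (2 * L - ln L)) by [].
by rewrite /s; field; rewrite gt_eqF.
Qed.

End implied_volatility.

(** * Expected call payoffs: positivity and decay in the strike *)

Section call_payoff.
Context d (Omega : measurableType d) (R : realType) (P : probability Omega R).
Variable Y : Omega -> R.
Hypothesis mY : measurable_fun setT Y.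
Hypothesis Y0 : forall w, 0 <= Y w.
Hypothesis EY : ('E_P[Y] < +oo)%E.

Let f K w : R := Num.max (Y w - K) 0.

Let f0 K w : 0 <= f K w.
Proof. by rewrite /f le_max lexx orbT. Qed.

Let mf K : measurable_fun setT (f K).
Proof.
by apply: measurable_maxr; [apply: measurable_funB|exact: measurable_cst].
Qed.

Let fY K w : 0 <= K -> f K w <= Y w.
Proof. by move=> K0; rewrite /f ge_max Y0 gerBl K0. Qed.

Lemma call_payoff_fin_num K : 0 <= K -> ('E_P[f K] \is a fin_num)%E.
Proof.
move=> K0; rewrite ge0_fin_numE ?expectation_ge0//.
apply: le_lt_trans EY; apply: expectation_le => //.
by apply: aeW => w; exact: fY.
Qed.

(** The payoff is at least 1 on the event Y > K + 1, so its expectation is at least the probability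
    of that event. *)
Lemma call_payoff_gt0 K : 0 <= K -> (0 < P [set w | (K + 1 < Y w)%R])%E ->
  0 < fine 'E_P[f K].
Proof.
move=> K0 PK; rewrite -lte_fin fineK ?call_payoff_fin_num//.
apply: lt_le_trans PK _.
have mA : measurable [set w | K + 1 < Y w].
  rewrite -[X in measurable X]setTI.
  have -> : [set w | K + 1 < Y w] = Y @^-1` `]K + 1, +oo[.
    by apply/seteqP; split => w /=; rewrite in_itv/= andbT.
  exact: mY.
rewrite -(expectation_indic P mA); apply: expectation_le => //.
apply: aeW => w; rewrite indicE; case: (boolP (w \in _)) => //.
by rewrite inE/= => h; rewrite /f le_max; apply/orP; left; lra.
Qed.

(** Dominated convergence, with [Y] dominating, treats integer strikes; monotonicity in the strike
    extends the bound to all large real [K]. *)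
Lemma call_payoff_cvg0 (e : R) : 0 < e ->
  \forall K \near +oo, fine 'E_P[f K] <= e.
Proof.
move=> e0.
have iY : P.-integrable setT (EFin \o Y).
  apply/integrableP; split; first exact/measurable_EFinP.
  under eq_integral do rewrite /= ger0_norm//.
  by move: EY; rewrite unlock.
have fcvg : [sequence (\int[P]_w (f n%:R w)%:E)%E]_n @ \oo --> 0%:E.
  have mfE (n : nat) : measurable_fun setT (EFin \o f n%:R).
    exact/measurable_EFinP.
  have cf : {ae P, forall w, [set: Omega] w ->
      (EFin \o f n%:R) w @[n --> \oo] --> (cst 0%E : Omega -> \bar R) w}.
    apply: aeW => w _; apply: cvg_near_cst.
    near=> n; rewrite /= /f max_r// subr_le0.
    by near: n; exact: nbhs_infty_ger.
  have dom : {ae P, forall w (n : nat), [set: Omega] w ->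
      (`|(EFin \o f n%:R) w| <= (EFin \o Y) w)%E}.
    by apply: aeW => w n _; rewrite /= lee_fin ger0_norm//; exact: fY.
  have [_ _] := dominated_convergence measurableT mfE (measurable_cst _) cf iY dom.
  by rewrite integral0.
have [n _ /(_ n (leqnn n))] : \forall n \near \oo, fine 'E_P[f n%:R] <= e.
  have /fine_cvg/cvgrPdist_le/(_ _ e0) := fcvg.
  apply: filterS => n /=; rewrite sub0r normrN unlock.
  by apply: le_trans; exact: ler_norm.
move=> fne; near=> K.
have nK : n%:R <= K by near: K; exact: nbhs_pinfty_ge.
have K0 : 0 <= K by apply: le_trans nK.
apply: le_trans fne; apply: fine_le; rewrite ?call_payoff_fin_num//.
apply: expectation_le => //; apply: aeW => w.
by rewrite /f ge_max !le_max lerB// lexx orbT.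
Unshelve. all: by end_near. Qed.

End call_payoff.

(** * Call prices of a stock price process *)

Section stock.
Context d (Omega : measurableType d) (R : realType) (P : probability Omega R).
Variables (F : R -> set (set Omega)) (r x0 : R) (X : R -> Omega -> R) (T : R).
Hypothesis hF : is_filtration F.
Hypothesis hX : stock_price P F r x0 X.
Hypothesis T0 : 0 < T.

Let mX : measurable_fun setT (X T).
Proof.
move=> _ B mB; rewrite setTI; have [_ FT _] := hF.
by apply: (FT _ (ltW T0)); exact: (stock_price_adapted hX (ltW T0)).
Qed.

Let X_ge0 w : 0 <= X T w.
Proof. exact/ltW/(stock_price_gt0 hX)/ltW. Qed.

Let EX := stock_price_finite hX (ltW T0).

Lemma call_price_gt0 K : 0 <= K -> 0 < call_price P r X T K.
Proof.
move=> K0; rewrite mulr_gt0 ?expR_gt0// call_payoff_gt0//.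
exact: (stock_price_unbounded hX).
Qed.

Lemma call_price_cvg0 (e : R) : 0 < e ->
  \forall K \near +oo, call_price P r X T K <= e.
Proof.
move=> e0; have e'0 : 0 < expR (r * T) * e by rewrite mulr_gt0 ?expR_gt0.
have := call_payoff_cvg0 _ _ _ _ _ mX X_ge0 EX _ e'0; apply: filterS => K ?.
by rewrite /call_price expRN mulrC ler_pdivrMr ?expR_gt0// mulrC.
Qed.

End stock.

Theorem theorem2p1 (R : realType) (d : measure_display)
    (Omega : measurableType d) (P : probability Omega R)
    (F : R -> set (set Omega)) (r x0 : R) (X : R -> Omega -> R)
    (T : R) (psi : R -> R)
    (hr : 0 <= r) (hx0 : 0 < x0)
    (hF : is_filtration F)
    (hX : stock_price P F r x0 X)
    (hT : 0 < T)
    (hpsi_pos : forall K : R, 0 < K -> 0 < psi K)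
    (hpsi_lim : psi K @[K --> +oo] --> +oo) :
  let C := call_price P r X in
  let I := implied_vol r x0 C in
  let L := fun K : R => ln (1 / C T K) in
  eq_addO_pinfty
    (fun K => I T K)
    (fun K => 1 / Num.sqrt T *
      (Num.sqrt (2 * ln K + 2 * L K - ln (L K))
       - Num.sqrt (2 * L K - ln (L K))))
    (fun K => (L K) `^ (- (1 / 2)) * psi K).
Proof.
move=> C I L.
have [e [M [alpha [e0 alpha0 hI]]]] := implied_vol_asymptotics R r x0 T hx0 hT.
have C_small := call_price_cvg0 _ _ _ _ _ _ _ _ _ hF hX hT _ e0.
have psi_ge1 : \forall K \near +oo, 1 <= psi K.
  by move/cvgryPge : hpsi_lim; exact.
exists alpha => //; near=> K.
have K0 : 0 < K by near: K; exact: nbhs_pinfty_gt.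
have MK : M <= ln K.
  have eMK : expR M <= K by near: K; apply: nbhs_pinfty_ge; exact: num_real.
  by rewrite -[M]expRK ler_ln ?posrE ?expR_gt0.
have CK : 0 < C T K <= e.
  rewrite (call_price_gt0 _ _ _ _ _ _ _ _ _ hF hX hT _ (ltW K0))/=.
  by near: K.
have psiK : 1 <= psi K by near: K.
have [L0] := hI C K K0 MK CK.
(* The error is at most alpha L^(-1/2), and psi(K) >= 1 for large [K]. *)
move=> /le_trans; apply.
by rewrite ler_pM2l// ler_peMr// powR_ge0.
Unshelve. all: by end_near. Qed.
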